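(* Let $G$ be an unweighted digraph without loops, let $0\le\omega<1$ and $\tau=1-\omega$, and let $M_\tau(t)=I-At+(D-\tau I)\tau t^2+(A-S)\tau^2t^3$. Let $\mu$, $0<\mu\le1/\tau$, be the smallest positive real eigenvalue of $M_\tau(t)$, and let $r$ be the radius of convergence of $\sum_{k=0}^\infty t^kq_k(A,\omega)$ (which equals $(1-\tau^2t^2)M_\tau(t)^{-1}$ near $t=0$). Let $H_1,\dots,H_s$ be the undirectizations of the strongly connected or single node components of $G$. If some $H_i$ has more than one cycle, then $\mu=r<1/\tau$.
   Context: $G=(V,E)$, adjacency matrix $A$, $S=A\circ A^T$, $D=\mathrm{diag}(\mathrm{diag}(A^2))$. A walk $(v_1,\dots,v_{k+1})$ of length $k$ backtracks at position $r$ if $v_{r+2}=v_r$; $q_k(A,\omega)$ is the $n\times n$ matrix whose $(i,j)$ entry is $\sum \omega^{m(w)}$ over all walks $w$ of length $k$ from $i$ to $j$, where $m(w)$ is the number of backtracking positions of $w$ ($q_0=I$). Components: induced subgraphs on classes of ''$i=j$ or mutually reachable''. Undirectization: undirected simple graph with edge $\{i,j\}$ whenever $(i,j)$ or $(j,i)\in E$; a cycle is a closed path of length $\ge3$ up to cyclic permutations and reversal. *)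

(* Defs.v *)
From HB Require Import structures.
From mathcomp Require Import all_boot all_order all_algebra.
From mathcomp Require Import all_classical all_reals topology normedtype sequences.
Set Implicit Arguments. Unset Strict Implicit. Unset Printing Implicit Defensive.
Import Order.TTheory GRing.Theory Num.Theory.
Import numFieldNormedType.Exports.
Local Open Scope classical_set_scope.
Local Open Scope ring_scope.

Section Defs.
Variable R : realType.
Variable n : nat.
Variable E : rel 'I_n.

Definition adjmx : 'M[R]_n := \matrix_(i, j) (E i j)%:R.
Definition Smx : 'M[R]_n := \matrix_(i, j) (adjmx i j * adjmx^T i j).
Definition Dmx : 'M[R]_n := \matrix_(i, j) ((i == j)%:R * (adjmx *m adjmx) i i).

Definition Mtau (tau t : R) : 'M[R]_n :=
  1%:M - t *: adjmx + (tau * t ^+ 2) *: (Dmx - tau%:M)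
  + (tau ^+ 2 * t ^+ 3) *: (adjmx - Smx).

(* A walk of length k from x is the vertex sequence x :: p with size p = k
   and path E x p.  Number of backtracking positions of the walk
   (v_1,...,v_{k+1}) = x :: p : positions r (0-based here) with v_{r+2} = v_r. *)
Definition backtracks (x : 'I_n) (p : seq 'I_n) : nat :=
  let s := x :: p in
  count (fun r => nth x s r.+2 == nth x s r) (iota 0 (size s - 2)).

Definition qmx (omega : R) (k : nat) : 'M[R]_n :=
  \matrix_(i, j) \sum_(p : k.-tuple 'I_n | path E i p && (last i p == j))
                    omega ^+ backtracks i p.

Definition radius_of_convergence (c : nat -> 'M[R]_n) (r : R) : Prop :=
  0 <= r /\
  (forall t : R, `|t| < r -> forall i j,
      cvg (series (fun k => c k i j * t ^+ k) @ \oo)) /\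
  (forall t : R, r < `|t| -> exists i j,
      ~ cvg (series (fun k => c k i j * t ^+ k) @ \oo)).

Definition smallest_pos_eigenvalue (tau mu : R) : Prop :=
  0 < mu /\ \det (Mtau tau mu) = 0 /\
  (forall t : R, 0 < t -> t < mu -> \det (Mtau tau t) != 0).

Definition scc (v : 'I_n) : {set 'I_n} :=
  [set u | connect E v u && connect E u v].

Definition undir_adj (C : {set 'I_n}) : rel 'I_n :=
  fun x y => [&& x \in C, y \in C, x != y & E x y || E y x].

Definition is_graph_cycle (e : rel 'I_n) (c : seq 'I_n) : bool :=
  (3 <= size c)%N && ucycleb e c.

Definition same_cycle (c1 c2 : seq 'I_n) : Prop :=
  exists k, c2 = rot k c1 \/ c2 = rot k (rev c1).

Definition has_more_than_one_cycle (e : rel 'I_n) : Prop :=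
  exists c1 c2, is_graph_cycle e c1 /\ is_graph_cycle e c2 /\ ~ same_cycle c1 c2.
End Defs.

(* Main.v *)
Require Import Defs.
From HB Require Import structures.
From mathcomp Require Import all_boot all_order all_algebra.
From mathcomp Require Import all_classical all_reals topology normedtype sequences.
From mathcomp Require Import derive zify ring lra.
Set Implicit Arguments. Unset Strict Implicit. Unset Printing Implicit Defensive.
Import Order.TTheory GRing.Theory Num.Theory.
Import numFieldNormedType.Exports.

(** Let s_k be the sum of the entries of q_k.  Concatenating walks only adds
    backtracks, so s_(k+l) <= s_k s_l.  Hence the t >= 0 with s_m t^m < 1 for
    some m >= 1 form an interval [0, r[, and r is the radius of convergence;
    moreover s_k r^k >= 1 for all k >= 1.

    The recurrence of the q_k turns M(t) sum_(k < N) t^k q_k into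
    (1 - tau^2 t^2) I plus a term vanishing as N grows when 0 < t < r, so M(t)
    is invertible there as soon as r < 1/tau.  It also gives
    |det M(t)| sum_(k < K) t^k q_k <= |(1 - tau^2 t^2) adj M(t)| entrywise for
    t < r and all K; letting t tend to r, the left-hand side is at least of
    order K |det M(r)|, whence det M(r) = 0.

    Finally r < 1 <= 1/tau because non-backtracking walks grow exponentially:
    some arc e has two distinct non-backtracking successors from which one can
    return to e.  Otherwise fix a directed cycle Z of length >= 3 in the
    component.  No non-backtracking walk can leave Z and come back to it, so
    every vertex off Z has a unique parent through which it is entered from Z
    and left towards Z; the component is then Z with trees attached to it, and
    Z is its only undirected cycle. *)

(** * Directed cycles and non-backtracking walks *)

Section CyclicSequences.
Variable T : finType.
Implicit Types (x y : T) (c Z : seq T).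

Lemma next_next_neq c x : uniq c -> 2 < size c -> x \in c ->
  next c (next c x) != x.
Proof.
move=> Uc c3 /rot_to[i q def_c].
have Uq : uniq (x :: q) by rewrite -def_c rot_uniq.
have q3 : 2 < size (x :: q) by rewrite -def_c size_rot.
rewrite -!(next_rot i Uc) def_c.
case: q Uq q3 {def_c} => [|y [|z q]] //= /andP[].
rewrite !inE !negb_or => /and3P[xy xz _] /andP[yz _] _.
by rewrite eqxx [y == x]eq_sym (negbTE xy) eqxx [z == x]eq_sym.
Qed.

Lemma prev_next_neq c x : uniq c -> 2 < size c -> x \in c ->
  prev c x != next c x.
Proof.
move=> Uc c3 cx; rewrite -(inj_eq (can_inj (prev_next Uc))) (next_prev Uc).
by rewrite eq_sym next_next_neq.
Qed.

(** Up to rotation, both sequences list the orbit of a common vertex under [next Z]. *)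
Lemma fcycle_next_rot Z c : uniq Z -> uniq c -> (exists2 x, x \in c & x \in Z) ->
  fcycle (next Z) c -> exists i j, rot i c = rot j Z.
Proof.
move=> UZ Uc [x cx Zx] fc; exists (index x c), (index x Z).
by rewrite -(orbitE fc Uc cx) -(orbitE (cycle_next UZ) UZ Zx).
Qed.

(* Once a cycle moves forward along Z it can never turn back, as it has no
   repeated vertex; so it follows either Z or its reversal. *)
Lemma cycle_in_cycle Z c : uniq Z -> uniq c -> 2 < size c ->
  {subset c <= Z} ->
  {in c, forall x, next c x = next Z x \/ next c x = prev Z x} ->
  exists i j, rot i c = rot j Z \/ rot i c = rot j (rev Z).
Proof.
move=> UZ Uc c3 cZ step.
have [x0 cx0] : exists x, x \in c.
  by case: c c3 {Uc cZ step} => // x c; exists x; rewrite inE eqxx.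
have turn x : x \in c -> next c x = next Z x ->
    next c (next c x) = next Z (next c x).
  move=> cx e; case: (step (next c x)); rewrite ?mem_next // => e'.
  by have := next_next_neq Uc c3 cx; rewrite e' e prev_next // eqxx.
have [allF|] := boolP (all (fun x => next c x == next Z x) c).
  have fc : fcycle (next Z) c.
    by apply: cycle_from_next => // x cx; rewrite /= eq_sym; apply: (allP allF).
  have [|i [j e]] := fcycle_next_rot UZ Uc _ fc; first by exists x0; rewrite ?cZ.
  by exists i, j; left.
case/allPn => x cx xN.
have noF y : y \in c -> next c y = prev Z y.
  move=> cy; case: (step y cy) => // e; exfalso.
  have : fconnect (next c) y x by rewrite (fconnect_cycle (cycle_next Uc)).
  case/connectP => p; elim: p y cy e => [|z p IH] y cy e /=.
    by move=> _ yx; move: xN; rewrite yx e eqxx.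
  case/andP => /eqP <- pz lz; apply: IH pz lz; first by rewrite mem_next.
  exact: turn.
have UrZ : uniq (rev Z) by rewrite rev_uniq.
have fc : fcycle (next (rev Z)) c.
  by apply: cycle_from_next => // y cy; rewrite /= next_rev // noF.
have [|i [j e]] := fcycle_next_rot UrZ Uc _ fc.
  by exists x0; rewrite // mem_rev cZ.
by exists i, j; right.
Qed.

End CyclicSequences.

Section NonBacktracking.
Variables (T : finType) (E : rel T).

(* Arcs are pairs (tail, head). *)
Definition nb (e f : T * T) : bool :=
  [&& E e.1 e.2, E f.1 f.2, e.2 == f.1 & e.1 != f.2].

(** Equivalently, some nontrivial strong component of the graph [nb] on arcs is not a single
    directed cycle. *)
Definition branching : Prop :=
  exists e f g, [/\ f != g, nb e f, nb e g, connect nb f e & connect nb g e].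

Variable Z : seq T.
Hypotheses (UZ : uniq Z) (cZ : cycle E Z) (Z3 : 2 < size Z).

Let zarc x := (x, next Z x).
Let fwd f := exists2 x, x \in Z & connect nb (zarc x) f.
Let bwd f := exists2 x, x \in Z & connect nb f (zarc x).

Let zarcE x : x \in Z -> E x (next Z x).
Proof. exact: next_cycle. Qed.

Let zarc_step x : x \in Z -> nb (zarc x) (zarc (next Z x)).
Proof.
move=> Zx; rewrite /nb /= eqxx !zarcE ?mem_next //=.
by rewrite eq_sym next_next_neq.
Qed.

Let zarc_connect x y : x \in Z -> y \in Z -> connect nb (zarc x) (zarc y).
Proof.
move=> Zx Zy.
have /connectP[p] : fconnect (next Z) x y by rewrite (fconnect_cycle (cycle_next UZ)).
elim: p x Zx => [|z p IH] x Zx /=; first by move=> _ ->; apply: connect0.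
case/andP => /eqP <- pz ey.
apply: connect_trans (connect1 (zarc_step Zx)) _.
by apply: IH pz ey; rewrite mem_next.
Qed.

Let fwdE f : fwd f -> E f.1 f.2.
Proof.
case=> x Zx /connectP[p]; case/lastP: p => [_ -> /=|p g]; first exact: zarcE.
by rewrite rcons_path last_rcons => /andP[_ /and4P[_ Eg _ _]] ->.
Qed.

Let bwdE f : bwd f -> E f.1 f.2.
Proof.
case=> x Zx /connectP[[|g p] /=]; first by move=> _ <-; exact: zarcE.
by case/andP => /and4P[].
Qed.

Let fwd_step e f : fwd e -> nb e f -> fwd f.
Proof. by case=> x Zx c /connect1 n; exists x => //; apply: connect_trans n. Qed.

Let bwd_step e f : nb e f -> bwd f -> bwd e.
Proof. by move=> /connect1 n [x Zx c]; exists x => //; apply: connect_trans c. Qed.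

Let fwd_zarc x : x \in Z -> fwd (zarc x).
Proof. by move=> Zx; exists x. Qed.

Let bwd_zarc x : x \in Z -> bwd (zarc x).
Proof. by move=> Zx; exists x. Qed.

Hypothesis nobranch : ~ branching.

(* Leaving Z and coming back yields two closed walks through the last arc
   before the departure. *)
Let fwd_bwd_zarc f : fwd f -> bwd f -> f.1 \in Z /\ f.2 = next Z f.1.
Proof.
move=> [x Zx /connectP[p]] + + [y Zy fy].
elim: p x Zx => [|g p IH] x Zx /=; first by move=> _ ->.
case/andP => ng pg ef.
have [gz|gz] := eqVneq g (zarc (next Z x)).
  by subst g; apply: IH pg ef; rewrite mem_next.
case: nobranch; exists (zarc x), g, (zarc (next Z x)); split => //.
- exact: zarc_step.
- have gf : connect nb g f by apply/connectP; exists p.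
  exact: connect_trans gf (connect_trans fy (zarc_connect Zy Zx)).
- by apply: zarc_connect; rewrite ?mem_next.
Qed.

(** Otherwise [(u, x)] followed by [(x, w)] would lie on a non-backtracking excursion from [Z] back
    to [Z] through [x], which is off [Z]. *)
Let parent_uniq x u w : x \notin Z -> fwd (u, x) -> bwd (x, w) -> u = w.
Proof.
move=> xZ F B; apply/eqP/negPn/negP => uw.
have n : nb (u, x) (x, w).
  by rewrite /nb /= eqxx uw (fwdE F) (bwdE B).
have [/= uZ xe] := fwd_bwd_zarc F (bwd_step n B).
by move: xZ; rewrite xe mem_next uZ.
Qed.

Let enter_bwd x z : x \notin Z -> z \in Z -> E x z -> bwd (x, z).
Proof.
move=> xZ zZ Exz; apply: bwd_step (bwd_zarc zZ).
rewrite /nb /= eqxx Exz zarcE //=.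
by apply: contraNneq xZ => ->; rewrite mem_next.
Qed.

Let leave_fwd z x : z \in Z -> x \notin Z -> E z x -> fwd (z, x).
Proof.
move=> zZ xZ Ezx; apply: (@fwd_step (zarc (prev Z z))).
  by apply: fwd_zarc; rewrite mem_prev.
rewrite /nb /= next_prev // eqxx Ezx prev_cycle //=.
by apply: contraNneq xZ => <-; rewrite mem_prev.
Qed.

(** A path without repeated vertices does not backtrack; it is followed up to its first arc into
    [Z], where [enter_bwd] applies. *)
Let bwd_path p x y : x \notin Z -> path E x (y :: p) -> uniq [:: x, y & p] ->
  last y p \in Z -> bwd (x, y).
Proof.
elim: p x y => [|w p IH] x y xZ /=.
  by rewrite andbT => Exy _ yZ; apply: enter_bwd.
case/and3P => Exy Eyw pw /andP[xyp /andP[ywp Up]] lZ.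
have [yZ|yZ] := boolP (y \in Z); first exact: enter_bwd.
apply: bwd_step (IH y w yZ _ _ lZ); rewrite /= ?Eyw ?ywp //.
rewrite /nb /= eqxx Exy Eyw /=.
by move: xyp; rewrite !inE !negb_or => /and3P[].
Qed.

Let bwd_exists x : x \notin Z -> (exists2 z, z \in Z & connect E x z) ->
  exists w, bwd (x, w).
Proof.
move=> xZ [z zZ /connectP[p0 pth ez]]; move: zZ; rewrite {}ez {z}.
case: (shortenP pth) => {pth p0} -[|y p] pth Up _ lZ.
  by move: xZ; rewrite lZ.
by exists y; apply: (bwd_path xZ pth Up lZ).
Qed.

Let Fixpoint reach k x :=
  if k is k'.+1 then [exists u, reach k' u && E u x] else x \in Z.

(** A shortest walk from [Z] never backtracks: a vertex met again two steps later would have been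
    reached earlier. *)
Let reach_fwd k x : reach k.+1 x -> (forall j, j <= k -> ~~ reach j x) ->
  exists u, [/\ fwd (u, x), reach k u & forall j, j < k -> ~~ reach j u].
Proof.
elim: k x => [|k IH] x /existsP[u /andP[ru Eux]] rN.
  by exists u; split => //; apply: leave_fwd => //; apply: (rN 0).
have uN j : j <= k -> ~~ reach j u.
  move=> jk; apply/negP => rj; have /negP[] := rN j.+1 jk.
  by apply/existsP; exists u; apply/andP.
have [w [Fw rw wN]] := IH u ru uN.
exists u; split => //; apply: (fwd_step Fw).
rewrite /nb /= eqxx Eux (fwdE Fw) /=.
by apply: contraNneq (rN k (leqnSn k)) => <-.
Qed.

Let level : exists lvl : T -> nat, forall x, x \notin Z ->
  (exists2 z, z \in Z & connect E z x) -> exists2 u, fwd (u, x) & lvl u < lvl x.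
Proof.
(* The distance from [Z], with default 0 for vertices out of reach. *)
pose lvl x := if pselect (exists k, reach k x) is left ex then ex_minn ex else 0.
have lvlE k x : reach k x -> (forall j, j < k -> ~~ reach j x) -> lvl x = k.
  rewrite /lvl => rk kN; case: pselect => [ex|[]]; last by exists k.
  case: ex_minnP => m rm mN; apply/eqP; rewrite eqn_leq mN //= leqNgt.
  by apply/negP => /kN/negP.
exists lvl => x xZ [z zZ zx].
have exk : exists k, reach k x.
  case/connectP: zx => p + ->; elim/last_ind: p => [|p y IH] /=; first by exists 0.
  rewrite rcons_path last_rcons => /andP[/IH[k rk] Ey].
  by exists k.+1; apply/existsP; exists (last z p); apply/andP.
case: (ex_minnP exk) => -[|k] rk kmin; first by move: xZ; rewrite [_ \in _]rk.
have kN j : j < k.+1 -> ~~ reach j x.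
  by rewrite ltnNge => jk; apply: contra jk; apply: kmin.
have [u [Fu ru uN]] := reach_fwd rk kN.
by exists u => //; rewrite (lvlE k.+1 x) // (lvlE k u).
Qed.

Variable C : {set T}.
Hypothesis ZC : {subset Z <= C}.
Hypothesis CC : {in C &, forall x y, connect E x y}.

Let H x y := [&& x \in C, y \in C, x != y & E x y || E y x].

(* Off Z every vertex has a single parent, and a vertex of maximal level on a
   cycle would have its parent as both neighbours. *)
Let cycle_sub c : uniq c -> 2 < size c -> cycle H c -> {subset c <= Z}.
Proof.
move=> Uc c3 Hc; have [lvl lvlP] := level.
have cC x : x \in c -> x \in C by move=> /(next_cycle Hc)/and4P[].
have [z zZ] : exists z, z \in Z by case: (Z) Z3 => // z s; exists z; rewrite inE eqxx.
have fromZ x : x \in c -> exists2 z, z \in Z & connect E z x.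
  by move=> cx; exists z => //; apply: CC; [apply: ZC | apply: cC].
have toZ x : x \in c -> exists2 z, z \in Z & connect E x z.
  by move=> cx; exists z => //; apply: CC; [apply: cC | apply: ZC].
have parent x : x \in c -> x \notin Z -> exists u,
    [/\ fwd (u, x), lvl u < lvl x, forall v, fwd (v, x) -> v = u
      & forall w, bwd (x, w) -> w = u].
  move=> cx xZ; have [u Fu lu] := lvlP x xZ (fromZ x cx).
  have [w Bw] := bwd_exists xZ (toZ x cx).
  exists u; split=> // [v Fv|w' Bw'].
    by rewrite (parent_uniq xZ Fv Bw) (parent_uniq xZ Fu Bw).
  by rewrite (parent_uniq xZ Fu Bw').
move=> y0 cy0; apply: contraT => y0Z.
have [|x /andP[cx xZ] xmax] :=
    @arg_maxnP _ y0 [pred x | (x \in c) && (x \notin Z)] lvl.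
  by rewrite /= cy0 y0Z.
have [u [Fu lu Funiq Buniq]] := parent x cx xZ.
(* By maximality of [lvl x], no vertex of [c] off [Z] has [x] as its parent; so an arc between [x]
   and [y], in either direction, forces [y] to be the parent [u]. *)
have nbr y : y \in c -> E x y || E y x -> y = u.
  move=> cy /orP[Exy|Eyx].
    apply/eqP/negPn/negP => yu.
    have Fxy : fwd (x, y).
      by apply: (fwd_step Fu); rewrite /nb /= eqxx Exy (fwdE Fu) eq_sym.
    have [yZ|yZ] := boolP (y \in Z).
      by move: yu; rewrite (Buniq y) ?eqxx //; apply: enter_bwd.
    have [v [Fv lv vuniq _]] := parent y cy yZ.
    have ylex : lvl y <= lvl x by apply: xmax; rewrite /= cy yZ.
    by move: lv; rewrite -(vuniq x Fxy) ltnNge ylex.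
  have [yZ|yZ] := boolP (y \in Z); first by apply: Funiq; apply: leave_fwd.
  have [v [Fv lv vuniq _]] := parent y cy yZ.
  have ylex : lvl y <= lvl x by apply: xmax; rewrite /= cy yZ.
  apply: Funiq; apply: (fwd_step Fv); rewrite /nb /= eqxx Eyx (fwdE Fv) /=.
  by apply: contraTneq lv => ->; rewrite -leqNgt.
have pu : prev c x = u.
  apply: nbr; rewrite ?mem_prev // orbC.
  by have /and4P[] := prev_cycle Hc cx.
have nu : next c x = u.
  apply: nbr; rewrite ?mem_next //.
  by have /and4P[] := next_cycle Hc cx.
by have := prev_next_neq Uc c3 cx; rewrite pu nu eqxx.
Qed.

(** Between the arc of [Z] into [x] and the arc of [Z] out of [y], a chord would be a
    non-backtracking excursion; backtracking occurs only if [y = prev Z x]. *)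
Let no_chord x y : x \in Z -> y \in Z -> x != y -> E x y ->
  y = next Z x \/ y = prev Z x.
Proof.
move=> xZ yZ xy Exy; have [->|yp] := eqVneq y (prev Z x); [by right | left].
have F : fwd (x, y).
  apply: (@fwd_step (zarc (prev Z x))); first by apply: fwd_zarc; rewrite mem_prev.
  by rewrite /nb /= next_prev // eqxx Exy prev_cycle // eq_sym.
have B : bwd (x, y).
  apply: bwd_step (bwd_zarc yZ); rewrite /nb /= eqxx Exy zarcE //=.
  by apply: contraNneq yp => ->; rewrite prev_next.
by have [] := fwd_bwd_zarc F B.
Qed.

Lemma nobranch_unicyclic c : uniq c -> 2 < size c -> cycle H c ->
  exists i j, rot i c = rot j Z \/ rot i c = rot j (rev Z).
Proof.
move=> Uc c3 Hc; have cZ' := cycle_sub Uc c3 Hc.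
apply: cycle_in_cycle => // x cx.
have xZ := cZ' x cx; have yZ : next c x \in Z by apply: cZ'; rewrite mem_next.
have /and4P[_ _ xy /orP[Exy|Eyx]] := next_cycle Hc cx; first exact: no_chord.
rewrite eq_sym in xy; have [e|e] := no_chord yZ xZ xy Eyx.
  by right; rewrite [X in prev Z X]e prev_next.
by left; rewrite [X in next Z X]e next_prev.
Qed.

End NonBacktracking.

(** * Two undirected cycles force a branching arc *)

Lemma scc_connect n (E : rel 'I_n) v : {in scc E v &, forall x y, connect E x y}.
Proof.
move=> x y; rewrite !inE => /andP[_ xv] /andP[vy _]; exact: connect_trans xv vy.
Qed.

(* An arc of the undirected cycle without reverse arc closes a shortest path
   between its ends; if there is none the cycle itself is directed. *)
Lemma directed_cycle_exists n (E : rel 'I_n) v c :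
  is_graph_cycle (undir_adj E (scc E v)) c ->
  exists Z, [/\ uniq Z, cycle E Z, 2 < size Z & {subset Z <= scc E v}].
Proof.
case/andP => c3 /andP[Hc Uc].
have cC x : x \in c -> x \in scc E v by move=> /(next_cycle Hc)/and4P[].
have [dir|/allPn[x cx]] := boolP (all (fun x => E x (next c x)) c).
  by exists c; split => //; apply: cycle_from_next => // x cx; apply: (allP dir).
set y := next c x => Nxy.
have /and4P[xC yC xy] := next_cycle Hc cx; rewrite -/y (negbTE Nxy) /= => Eyx.
rewrite -/y in xy yC; clearbody y; have /connectP[p0 pth ey] := scc_connect xC yC.
move: ey; case: (shortenP pth) => {p0 pth} p pth Up _ ey.
exists (x :: p); split => //.
- by rewrite /= rcons_path pth -ey.
(* The path has at least two arcs, as [x != y] and [(x, y)] is not an arc. *)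
- case: p pth ey {Up} => [|a [|b p]] //=.
    by move=> _ /esym/eqP; rewrite (negbTE xy).
  by rewrite andbT => Exa ya; rewrite ya Exa in Nxy.
- move=> z zp; have xz := path_connect pth zp.
  have zy : connect E z y.
    case/splitPl: zp pth ey => p1 p2 <-; rewrite cat_path last_cat => /andP[_ p2p] ->.
    by apply/connectP; exists p2.
  move: xC yC; rewrite !inE => /andP[vx _] /andP[_ yv].
  by rewrite (connect_trans vx xz) (connect_trans zy yv).
Qed.

Lemma rot_cancel (T : Type) (s t : seq T) i : rot i s = t -> exists k, s = rot k t.
Proof. by move=> <-; exists (size (rot i s) - i); rewrite -[LHS](rotK i). Qed.

Lemma same_cycle_common n (Z c1 c2 : seq 'I_n) i1 j1 i2 j2 :
  rot i1 c1 = rot j1 Z \/ rot i1 c1 = rot j1 (rev Z) ->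
  rot i2 c2 = rot j2 Z \/ rot i2 c2 = rot j2 (rev Z) ->
  same_cycle c1 c2.
Proof.
have norm (c : seq 'I_n) i j s : rot i c = rot j s -> exists k, s = rot k c.
  move=> e; have [k ->] := rot_cancel (esym e); rewrite rot_rot_add; by eexists.
have norm' (c : seq 'I_n) i j s : rot i c = rot j s -> exists k, c = rot k s.
  move=> e; have [k ->] := rot_cancel e; rewrite rot_rot_add; by eexists.
have comb (s : seq 'I_n) (k l : nat) : exists m, rot k (rot l s) = rot m s.
  by rewrite rot_rot_add; eexists.
have revr (s : seq 'I_n) k : exists m, rev (rot k s) = rot m (rev s).
  by rewrite rev_rot; eexists.
move=> h1 h2.
have [k1 e1] : exists k, Z = rot k c1 \/ Z = rot k (rev c1).
  case: h1 => /norm[k e]; first by exists k; left.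
  by have [m em] := revr c1 k; exists m; right; rewrite -em -e revK.
case: h2 => /norm'[k2 ->]; rewrite /same_cycle; case: e1 => ->.
- by have [m ->] := comb c1 k2 k1; exists m; left.
- by have [m ->] := comb (rev c1) k2 k1; exists m; right.
- have [m ->] := revr c1 k1; have [m' ->] := comb (rev c1) k2 m.
  by exists m'; right.
- have [m ->] := revr (rev c1) k1; rewrite revK.
  by have [m' ->] := comb c1 k2 m; exists m'; left.
Qed.

(** Without branching, both cycles agree up to rotation and reversal with the directed cycle
    extracted from [c1]. *)
Lemma two_cycles_branching n (E : rel 'I_n) v :
  has_more_than_one_cycle (undir_adj E (scc E v)) -> branching E.
Proof.
move=> [c1 [c2 [h1 [h2 ndiff]]]]; apply: contrapT => nobr; apply: ndiff.
have [Z [UZ cZ Z3 ZC]] := directed_cycle_exists h1.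
have uni c : is_graph_cycle (undir_adj E (scc E v)) c ->
    exists i j, rot i c = rot j Z \/ rot i c = rot j (rev Z).
  case/andP => c3 /andP[Hc Uc].
  exact: (nobranch_unicyclic UZ cZ Z3 nobr ZC (@scc_connect _ _ v)).
have [i1 [j1 e1]] := uni _ h1; have [i2 [j2 e2]] := uni _ h2.
exact: same_cycle_common e1 e2.
Qed.

(** * Weighted walks and the recurrence of the q_k *)

Local Open Scope classical_set_scope.
Local Open Scope ring_scope.

Lemma big_tuple_cons (R : nmodType) (T : finType) k (F : seq T -> R) :
  \sum_(p : k.+1.-tuple T) F p = \sum_b \sum_(q : k.-tuple T) F (b :: q).
Proof.
rewrite pair_big /= (reindex (fun bq : T * k.-tuple T => cons_tuple bq.1 bq.2)) //=.
exists (fun p : k.+1.-tuple T => (thead p, behead_tuple p)) => [[b q] _|p _] /=.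
  by congr pair; apply: val_inj.
by rewrite [in RHS](tuple_eta p); apply: val_inj.
Qed.

Lemma backtracks1 n (a b : 'I_n) : backtracks a [:: b] = 0%N.
Proof. by []. Qed.

Lemma backtracks_cons2 n (a b c : 'I_n) q :
  backtracks a [:: b, c & q] = ((c == a) + backtracks b (c :: q))%N.
Proof.
rewrite /backtracks /= !subSS !subn0; congr addn.
(* Dropping [a] shifts positions by one and changes the default of [nth], harmlessly since all
   indices are in range. *)
rewrite (iotaDl 1 0) count_map; apply: eq_in_count => r; rewrite mem_iota add0n.
by case: r => [|r] /= lt_r; rewrite add0n !(set_nth_default b a) //=; lia.
Qed.

Section WalkWeights.
Variables (R : realType) (n : nat) (E : rel 'I_n) (omega : R).
Hypotheses (omega0 : 0 <= omega) (omega1 : omega < 1).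
Local Notation tau := (1 - omega).
Local Notation q := (qmx E omega).
Local Notation A := (adjmx R E).
Local Notation D := (Dmx R E).
Local Notation S := (Smx R E).
Local Notation M := (Mtau E tau).

(* Total weight of the walks that traverse the arc (a, b) and reach j after k
   further steps. *)
Fixpoint arc_weight k (a b j : 'I_n) : R :=
  if k is k'.+1 then
    \sum_(c | E b c) (if c == a then omega else 1) * arc_weight k' b c j
  else (b == j)%:R.
Local Notation u := arc_weight.

Lemma arc_weightE k a b j : u k a b j =
  \sum_(p : k.-tuple 'I_n | path E b p && (last b p == j))
    omega ^+ backtracks a (b :: p).
Proof.
elim: k a b => [|k IH] a b /=.
  rewrite big_mkcond (bigD1 [tuple]) //= big1 ?addr0 => [|p]; last first.
    by move=> /negP[]; apply/eqP; rewrite [p]tuple0.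
  by rewrite backtracks1 expr0; case: eqP.
rewrite [RHS]big_mkcond (big_tuple_cons _ (fun p => if path E b p && (last b p == j)
   then omega ^+ backtracks a (b :: p) else 0)).
rewrite big_mkcond; apply: eq_bigr => c _ /=; case: ifP => Ebc /=; last first.
  by rewrite big1.
rewrite IH big_distrr /= [LHS]big_mkcond; apply: eq_bigr => p _.
case: ifP => // _; rewrite backtracks_cons2 exprD.
by case: eqP; rewrite ?expr1 ?expr0.
Qed.

Lemma qmx0 : q 0 = 1%:M.
Proof.
apply/matrixP => i j; rewrite !mxE big_mkcond (bigD1 [tuple]) //= big1 ?addr0.
  by rewrite /backtracks /= expr0; case: eqP.
by move=> p /negP[]; apply/eqP; rewrite [p]tuple0.
Qed.

Lemma qmxS k i j : q k.+1 i j = \sum_(b | E i b) u k i b j.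
Proof.
rewrite mxE [LHS]big_mkcond (big_tuple_cons _ (fun p => if path E i p && (last i p == j)
   then omega ^+ backtracks i p else 0)).
rewrite [RHS]big_mkcond; apply: eq_bigr => b _ /=; case: ifP => Ebc /=; last first.
  by rewrite big1.
by rewrite arc_weightE [RHS]big_mkcond.
Qed.

Lemma arc_weight_ge0 k a b j : 0 <= u k a b j.
Proof.
elim: k a b => [|k IH] a b /=; first exact: ler0n.
by apply: sumr_ge0 => c _; apply: mulr_ge0 => //; case: ifP.
Qed.

Lemma qmx_ge0 k i j : 0 <= q k i j.
Proof.
case: k => [|k]; first by rewrite qmx0 mxE; apply: ler0n.
by rewrite qmxS; apply: sumr_ge0 => b _; apply: arc_weight_ge0.
Qed.

(** The arc [(a, b)] in front can only add a backtrack, at a factor [omega <= 1]. *)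
Lemma arc_weight_le_qmx k a b j : u k a b j <= q k b j.
Proof.
case: k => [|k]; first by rewrite qmx0 mxE.
rewrite qmxS /=; apply: ler_sum => c _; rewrite ler_piMl ?arc_weight_ge0 //.
by case: ifP => // _; exact: ltW.
Qed.

(** Splitting a walk at the vertex [m] forgets at most the backtrack at the junction; this is the
    base case. *)
Lemma arc_weight_submul k l a b j :
  u (k + l) a b j <= \sum_m u k a b m * q l m j.
Proof.
elim: k a b => [|k IH] a b.
  rewrite (bigD1 b) //= eqxx mul1r big1 ?addr0; first exact: arc_weight_le_qmx.
  by move=> m /negbTE; rewrite eq_sym => ->; rewrite mul0r.
have step : u (k.+1 + l) a b j <=
    \sum_(c | E b c) \sum_m (if c == a then omega else 1) * u k b c m * q l m j.
  apply: ler_sum => c _; under eq_bigr do rewrite -mulrA.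
  by rewrite -big_distrr /= ler_wpM2l //; case: ifP.
apply: le_trans step _; rewrite exchange_big /=.
by under eq_bigr do rewrite -big_distrl.
Qed.

Lemma qmx_submul k l i j : q (k + l) i j <= (q k *m q l) i j.
Proof.
case: k => [|k]; first by rewrite qmx0 mul1mx.
rewrite addSn qmxS mxE; under [leRHS]eq_bigr do rewrite qmxS big_distrl.
by rewrite exchange_big; apply: ler_sum => b _; apply: arc_weight_submul.
Qed.

(** An immediate return to [a] is charged [omega = 1 - tau] instead of 1; the last term corrects for
    it. *)
Lemma arc_weight_rec k a b j :
  u k.+1 a b j = q k.+1 b j - tau * (E b a)%:R * u k b a j.
Proof.
rewrite qmxS /= [in LHS]big_mkcond [in RHS]big_mkcond.
rewrite (bigD1 a) //= [in RHS](bigD1 a) //= eqxx.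
rewrite (eq_bigr (fun i => if E b i then u k b i j else 0)).
  by case: (E b a) => /=; ring.
by move=> c /negbTE ->; rewrite mul1r.
Qed.

Lemma arc_weight_notrec k a b j : ~~ E b a -> u k a b j = q k b j.
Proof.
case: k => [|k] Nba; first by rewrite qmx0 mxE.
by rewrite arc_weight_rec (negbTE Nba) mulr0 mul0r subr0.
Qed.

(** If [(b, a)] is an arc, this is [arc_weight_rec] applied twice; if not, the [tau ^+ 2] bracket
    vanishes. The factor [1 - E b a] in this common form produces [A - S]. *)
Lemma arc_weight_rec2 k a b j : E a b ->
  u k.+2 a b j = q k.+2 b j - tau * (E b a)%:R * q k.+1 a j
    + tau ^+ 2 * (u k a b j - (1 - (E b a)%:R) * q k b j).
Proof.
move=> Eab; rewrite arc_weight_rec.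
have [Eba|Nba] := boolP (E b a); first by rewrite arc_weight_rec Eab /=; ring.
by rewrite (@arc_weight_notrec k) //=; ring.
Qed.

Lemma mulDmx (X : 'M[R]_n) i j :
  (D *m X) i j = (\sum_(b | E i b) (E b i)%:R) * X i j.
Proof.
rewrite mxE (bigD1 i) //= big1 ?addr0 => [|k /negbTE ik]; last first.
  by rewrite mxE eq_sym ik !mul0r.
rewrite !mxE eqxx mul1r; congr (_ * _).
rewrite [RHS]big_mkcond; apply: eq_bigr => b _; rewrite !mxE.
by case: (E i b); rewrite ?mul1r ?mul0r.
Qed.

Lemma mulAmx (X : 'M[R]_n) i j : (A *m X) i j = \sum_(b | E i b) X b j.
Proof.
rewrite mxE [RHS]big_mkcond; apply: eq_bigr => b _; rewrite mxE.
by case: (E i b); rewrite ?mul1r ?mul0r.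
Qed.

Lemma mulASmx (X : 'M[R]_n) i j :
  ((A - S) *m X) i j = \sum_(b | E i b) (1 - (E b i)%:R) * X b j.
Proof.
rewrite mxE [RHS]big_mkcond; apply: eq_bigr => b _; rewrite !mxE.
by case: (E i b) (E b i) => -[]; rewrite ?mul1r ?mul0r ?subr0 ?mul1r ?subrr ?mul0r.
Qed.

Lemma mulDtaumx (X : 'M[R]_n) i j :
  ((D - tau%:M) *m X) i j = (\sum_(b | E i b) (E b i)%:R) * X i j - tau * X i j.
Proof. by rewrite mulmxBl mxE mulDmx mul_scalar_mx !mxE. Qed.

Lemma qmx1E : q 1 = A *m q 0.
Proof.
apply/matrixP => i j; rewrite qmxS mulAmx qmx0.
by apply: eq_bigr => b _; rewrite mxE.
Qed.

(** The extra term in [q 0], absent from the general recurrence, is the source of the factor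
    [1 - tau ^+ 2 * t ^+ 2]. *)
Lemma qmx2E i j : q 2 i j = (A *m q 1) i j - tau * ((D - tau%:M) *m q 0) i j
  - tau ^+ 2 * q 0 i j.
Proof.
rewrite qmxS mulAmx mulDtaumx.
under eq_bigr do rewrite arc_weight_rec.
rewrite sumrB /= -big_distrl -big_distrr /= qmx0 mxE eq_sym; ring.
Qed.

(** Sum [arc_weight_rec2] over the successors [b] of [i]: the terms [u k i b j] add up to
    [q k.+1 i j], which turns [D] into [D - tau I]. *)
Lemma qmx3E k i j : q k.+3 i j = (A *m q k.+2) i j
  - tau * ((D - tau%:M) *m q k.+1) i j - tau ^+ 2 * ((A - S) *m q k) i j.
Proof.
rewrite qmxS mulAmx mulDtaumx mulASmx.
under eq_bigr => b Eib do rewrite arc_weight_rec2 //.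
rewrite big_split sumrB /= -big_distrr /= sumrB -qmxS -big_distrl -big_distrr /=.
ring.
Qed.

(** * The truncated generating series and its defect *)

Definition psum (t : R) N : 'M[R]_n := \sum_(k < N) t ^+ k *: q k.

Definition defect (t : R) N : 'M[R]_n :=
  M t *m psum t N.+3 - (1 - tau ^+ 2 * t ^+ 2)%:M.

(** Here [a k], [b k], [c k], [d k] carry the powers [k], [k+1], [k+2], [k+3] of [t]; equal powers
    cancel, leaving the initial terms and those beyond the truncation. *)
Lemma telescope3 (a b c d : nat -> R) e :
  a 1%N = b 0%N -> a 2 = b 1%N - c 0%N - e ->
  (forall k, a k.+3 = b k.+2 - c k.+1 - d k) ->
  forall N, \sum_(k < N.+3) (a k - b k + c k + d k) =
    a 0%N - e - b N.+2 + c N.+1 + c N.+2 + d N + d N.+1 + d N.+2.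
Proof.
move=> a1 a2 a3; elim=> [|N IH].
  by rewrite !big_ord_recr big_ord0 /= a1 a2; ring.
by rewrite big_ord_recr /= IH a3; ring.
Qed.

Lemma mulMmx t (X : 'M[R]_n) i j : (M t *m X) i j = X i j - t * (A *m X) i j
  + tau * t ^+ 2 * ((D - tau%:M) *m X) i j
  + tau ^+ 2 * t ^+ 3 * ((A - S) *m X) i j.
Proof.
rewrite /Mtau; move: (D - tau%:M) (A - S) => D' S'.
rewrite !mulmxDl mulNmx mul1mx -!scalemxAl.
by move: (A *m X) (D' *m X) (S' *m X) => P1 P2 P3; rewrite !mxE.
Qed.

(** Only the last three terms of the truncated series survive, so the defect vanishes in the limit
    whenever these do. *)
Lemma defectE t N i j : defect t N i j =
  - t * (A *m (t ^+ N.+2 *: q N.+2)) i j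
  + tau * t ^+ 2 * ((D - tau%:M) *m (t ^+ N.+1 *: q N.+1)) i j
  + tau * t ^+ 2 * ((D - tau%:M) *m (t ^+ N.+2 *: q N.+2)) i j
  + tau ^+ 2 * t ^+ 3 * ((A - S) *m (t ^+ N *: q N)) i j
  + tau ^+ 2 * t ^+ 3 * ((A - S) *m (t ^+ N.+1 *: q N.+1)) i j
  + tau ^+ 2 * t ^+ 3 * ((A - S) *m (t ^+ N.+2 *: q N.+2)) i j.
Proof.
pose a k := t ^+ k * q k i j.
pose b k := t ^+ k.+1 * (A *m q k) i j.
pose c k := tau * t ^+ k.+2 * ((D - tau%:M) *m q k) i j.
pose d k := tau ^+ 2 * t ^+ k.+3 * ((A - S) *m q k) i j.
have := @telescope3 a b c d (tau ^+ 2 * t ^+ 2 * q 0 i j).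
rewrite /a /b /c /d {a b c d} => tele.
have E1 : (M t *m psum t N.+3) i j = \sum_(k < N.+3)
   (t ^+ k * q k i j - t ^+ k.+1 * (A *m q k) i j
    + tau * t ^+ k.+2 * ((D - tau%:M) *m q k) i j
    + tau ^+ 2 * t ^+ k.+3 * ((A - S) *m q k) i j).
  rewrite /psum mulmx_sumr summxE; apply: eq_bigr => k _.
  by rewrite -scalemxAr mxE mulMmx !exprS expr0; ring.
have E2 : (defect t N) i j = (M t *m psum t N.+3) i j
    - (1 - tau ^+ 2 * t ^+ 2) * q 0 i j.
  by rewrite /defect [LHS]mxE; congr (_ + _); rewrite qmx0 !mxE mulr_natr.
have scaleE (B X : 'M[R]_n) c : (B *m (c *: X)) i j = c * (B *m X) i j.
  by rewrite -scalemxAr mxE.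
rewrite E2 E1 {}tele.
- by rewrite !scaleE !exprS expr0; ring.
- by rewrite qmx1E expr1.
- by rewrite qmx2E !exprS expr0; ring.
- by move=> k; rewrite qmx3E !exprS expr0; ring.
Qed.

End WalkWeights.

(** * Radius of convergence *)

Lemma poly_abs_le_left (R : realType) (p q : {poly R}) (r : R) : 0 < r ->
  (forall t, 0 < t -> t < r -> `|p.[t]| <= `|q.[t]|) -> `|p.[r]| <= `|q.[r]|.
Proof.
move=> r0 pq.
have pc (s : {poly R}) : `|s.[t]| @[t --> r^'-] --> `|s.[r]|.
  by apply: cvg_norm; apply: cvg_at_left_filter; apply: continuous_horner.
apply: ler_cvg_to (pc p) (pc q) _.
by near=> t; apply: pq; near: t; [exact: nbhs_left_gt | exact: nbhs_left_lt].
Unshelve. all: by end_near. Qed.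

Lemma cvg_sum0 (R : realType) (I T : Type) (F : set_system T) {FF : Filter F}
    (r : seq I) (f : I -> T -> R) :
  (forall i, f i x @[x --> F] --> 0) -> \sum_(i <- r) f i x @[x --> F] --> 0.
Proof.
move=> f0; have z : \sum_(i <- r) (0 : R) = 0 by rewrite big1.
by rewrite -[X in _ --> X]z; apply: cvg_big => //; exact: add_continuous.
Qed.

Lemma cvg_mull0 (R : realType) (T : Type) (F : set_system T) {FF : Filter F}
    (f : T -> R) c : f x @[x --> F] --> 0 -> c * f x @[x --> F] --> 0.
Proof. by move=> f0; rewrite -[X in _ --> X](mulr0 c); apply: cvgMl_tmp. Qed.

Lemma mulmx_cvg0 (R : realType) m n p (B : 'M[R]_(m, n)) (X : nat -> 'M[R]_(n, p)) :
  (forall i j, X k i j @[k --> \oo] --> 0) ->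
  forall i j, (B *m X k) i j @[k --> \oo] --> 0.
Proof.
move=> X0 i j; under eq_fun do rewrite mxE.
by apply: cvg_sum0 => l; apply: cvg_mull0; apply: X0.
Qed.

Section Radius.
Variables (R : realType) (n : nat) (E : rel 'I_n) (omega : R).
Hypotheses (omega0 : 0 <= omega) (omega1 : omega < 1).
Local Notation tau := (1 - omega).
Local Notation q := (qmx E omega).
Local Notation M := (Mtau E tau).

Let q_ge0 k i j : 0 <= q k i j. Proof. exact: qmx_ge0. Qed.

Definition qsum k : R := \sum_i \sum_j q k i j.
Local Notation s := qsum.

Lemma qsum_ge0 k : 0 <= s k.
Proof. by apply: sumr_ge0 => i _; apply: sumr_ge0. Qed.

Lemma qmx_le_qsum k i j : q k i j <= s k.
Proof.
rewrite /qsum (bigD1 i) //= (bigD1 j) //= -addrA lerDl addr_ge0 //.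
  exact: sumr_ge0.
by apply: sumr_ge0 => l _; apply: sumr_ge0.
Qed.

(** The entry sum of a product pairs column sums with row sums, and each row sum of [q l] is at most
    [s l]. *)
Lemma qsum_submul k l : s (k + l) <= s k * s l.
Proof.
have -> : s k = \sum_m \sum_i q k i m by rewrite /qsum exchange_big.
apply: (@le_trans _ _ (\sum_i \sum_j (q k *m q l) i j)).
  by do 2!apply: ler_sum => ? _; apply: qmx_submul.
have -> : \sum_i \sum_j (q k *m q l) i j =
    \sum_m (\sum_i q k i m) * (\sum_j q l m j).
  under [LHS]eq_bigr => i _.
    under eq_bigr => j _ do rewrite mxE.
    rewrite exchange_big /=; under eq_bigr do rewrite -big_distrr.
    over.
  by rewrite exchange_big /=; apply: eq_bigr => m _; rewrite big_distrl.
rewrite big_distrl /=; apply: ler_sum => m _; rewrite ler_wpM2l ?sumr_ge0 //.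
rewrite /qsum [leRHS](bigD1 m) //= lerDl.
by apply: sumr_ge0 => i _; apply: sumr_ge0.
Qed.

Lemma qsumM m L : s (m * L.+1) <= s m ^+ L.+1.
Proof.
elim: L => [|L IH]; first by rewrite muln1 expr1.
rewrite mulnS exprS; apply: le_trans (qsum_submul _ _) _.
by rewrite ler_wpM2l ?qsum_ge0.
Qed.

(* The interval [0, r[: it does not contain its supremum, being open on the
   right. *)
Definition conv_set : set R :=
  [set t | 0 <= t /\ exists2 m, (0 < m)%N & s m * t ^+ m < 1].

Lemma conv_set_down t t' : 0 <= t -> t <= t' -> conv_set t' -> conv_set t.
Proof.
move=> t0 tt' [t'0 [m m0 lt1]]; split=> //; exists m => //.
apply: le_lt_trans lt1; apply: ler_wpM2l; first exact: qsum_ge0.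
by rewrite lerXn2r ?nnegrE.
Qed.

Lemma conv_set_open t : conv_set t -> exists2 t', t < t' & conv_set t'.
Proof.
move=> [t0 [m m0 lt1]].
have c : (s m *: 'X^m : {poly R}).[x] @[x --> t^'+] --> (s m *: 'X^m : {poly R}).[t].
  by apply: cvg_at_right_filter; apply: continuous_horner.
have lt1' : (s m *: 'X^m : {poly R}).[t] < 1 by rewrite hornerZ hornerXn.
have near1 : \forall x \near t^'+, (s m *: 'X^m : {poly R}).[x] < 1.
  exact: cvgr_lt c _ lt1'.
near t^'+ => t'.
have tt' : t < t' by near: t'; exact: nbhs_right_gt.
exists t' => //; split; first exact: le_trans t0 (ltW tt').
exists m => //.
have : (s m *: 'X^m : {poly R}).[t'] < 1 by near: t'.
by rewrite hornerZ hornerXn.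
Unshelve. all: by end_near. Qed.

Lemma conv_set0 : conv_set 0.
Proof. by split=> //; exists 1%N => //; rewrite expr1 mulr0. Qed.

(** Removing a block of length [m] never decreases [s k * t ^+ k], since [s m * t ^+ m < 1]; this
    reduces to [k < m]. *)
Lemma conv_set_bounded t : conv_set t ->
  exists C, forall k, s k * t ^+ k <= C.
Proof.
move=> [t0 [m m0 lt1]]; exists (\sum_(k < m) s k * t ^+ k) => k.
have pos l : 0 <= s l * t ^+ l by rewrite mulr_ge0 ?qsum_ge0 ?exprn_ge0.
elim/ltn_ind: k => k IH; have [km|mk] := ltnP k m.
  by rewrite (bigD1 (Ordinal km)) //= lerDl sumr_ge0.
have lt_k : (k - m < k)%N by lia.
apply: le_trans (IH _ lt_k).
have -> : s k * t ^+ k = s (m + (k - m)) * (t ^+ m * t ^+ (k - m)).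
  by rewrite -exprD subnKC.
apply: (@le_trans _ _ ((s m * s (k - m)) * (t ^+ m * t ^+ (k - m)))).
  by rewrite ler_wpM2r ?qsum_submul // mulr_ge0 ?exprn_ge0.
by rewrite mulrACA ler_piMl // ltW.
Qed.

Lemma conv_set_cvg t t' : conv_set t' -> `|t| < t' -> forall i j,
  cvg (series (fun k => q k i j * t ^+ k) @ \oo).
Proof.
move=> ct' tt' i j; have [C Cb] := conv_set_bounded ct'.
have t'0 : 0 < t' by apply: le_lt_trans tt'.
apply: normed_cvg.
apply: (@series_le_cvg _ _ (geometric C (`|t| / t'))) => [k|k|k|].
- exact: normr_ge0.
- apply: mulr_ge0; last by rewrite exprn_ge0 // divr_ge0 // ltW.
  by apply: le_trans (Cb 0%N); rewrite mulr_ge0 ?qsum_ge0 ?exprn_ge0 ?ltW.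
- rewrite /= normrM normrX ger0_norm // expr_div_n mulrA.
  rewrite ler_pdivlMr ?exprn_gt0 // mulrAC ler_wpM2r ?exprn_ge0 //.
  apply: le_trans (Cb k); rewrite ler_wpM2r ?qmx_le_qsum //.
  by rewrite exprn_ge0 // ltW.
- apply: is_cvg_geometric_series.
  by rewrite ger0_norm ?(divr_ge0 _ (ltW t'0)) // ltr_pdivrMr // mul1r.
Qed.

(** If all entries converged, their terms would tend to 0, so [s k] times the k-th power of the
    modulus of [t] would drop below 1. *)
Lemma conv_setN_ncvg t : ~ conv_set `|t| -> exists i j,
  ~ cvg (series (fun k => q k i j * t ^+ k) @ \oo).
Proof.
move=> nt; apply: contrapT => /forallNP allc; apply: nt; split=> //.
have c0 i j : `|q k i j * t ^+ k| @[k --> \oo] --> 0.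
  apply/norm_cvg0P; apply: cvg_series_cvg_0; apply: contrapT => nc.
  by apply: (allc i); exists j.
have c1 : s k * `|t| ^+ k @[k --> \oo] --> 0.
  have -> : (fun k => s k * `|t| ^+ k) =
      (fun k => \sum_i \sum_j `|q k i j * t ^+ k|).
    apply/funext => k; rewrite /qsum big_distrl; apply: eq_bigr => i _.
    rewrite big_distrl; apply: eq_bigr => j _.
    by rewrite normrM normrX ger0_norm.
  by apply: cvg_sum0 => i; apply: cvg_sum0.
have near1 : \forall k \near \oo, s k * `|t| ^+ k < 1.
  exact: cvgr_lt c1 _ ltr01.
near \oo => k; exists k.
  by near: k; exact: nbhs_infty_gt.
by near: k.
Unshelve. all: by end_near. Qed.

(** * The determinant of M(t) below and at the radius *)

Lemma defect_cvg0 t t' : conv_set t' -> `|t| < t' ->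
  forall i j, defect E omega t N i j @[N --> \oo] --> 0.
Proof.
move=> ct' tt' i j.
have X0 i' j' : (t ^+ N *: q N) i' j' @[N --> \oo] --> 0.
  have -> : (fun N => (t ^+ N *: q N) i' j') = (fun N => q N i' j' * t ^+ N).
    by apply/funext => N; rewrite mxE mulrC.
  by apply: cvg_series_cvg_0; exact: conv_set_cvg ct' tt' i' j'.
have Y0 d (B : 'M[R]_n) : (B *m (t ^+ (N + d) *: q (N + d))) i j @[N --> \oo] --> 0.
  apply: mulmx_cvg0 => i' j'.
  by rewrite (cvg_shiftn d (fun N => (t ^+ N *: q N) i' j')).
have Y d (B : 'M[R]_n) c :
    c * (B *m (t ^+ (N + d) *: q (N + d))) i j @[N --> \oo] --> 0.
  exact: cvg_mull0 (Y0 d B).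
have -> : (fun N => defect E omega t N i j) = (fun N =>
    - t * (adjmx R E *m (t ^+ (N + 2) *: q (N + 2))) i j
    + tau * t ^+ 2 * ((Dmx R E - tau%:M) *m (t ^+ (N + 1) *: q (N + 1))) i j
    + tau * t ^+ 2 * ((Dmx R E - tau%:M) *m (t ^+ (N + 2) *: q (N + 2))) i j
    + tau ^+ 2 * t ^+ 3 * ((adjmx R E - Smx R E) *m (t ^+ (N + 0) *: q (N + 0))) i j
    + tau ^+ 2 * t ^+ 3 * ((adjmx R E - Smx R E) *m (t ^+ (N + 1) *: q (N + 1))) i j
    + tau ^+ 2 * t ^+ 3 * ((adjmx R E - Smx R E) *m (t ^+ (N + 2) *: q (N + 2))) i j).
  by apply/funext => N; rewrite defectE addn0 addn1 addn2.
by do 5![rewrite -[X in _ --> X]addr0; apply: cvgD; last exact: Y]; exact: Y.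
Qed.

(** A left null vector [v] of [M t] maps the defect to a fixed nonzero multiple of [v], although the
    defect tends to 0. *)
Lemma detM_neq0 t t' : conv_set t' -> `|t| < t' -> tau ^+ 2 * t ^+ 2 != 1 ->
  \det (M t) != 0.
Proof.
move=> ct' tt' t1; apply/negP => /det0P[v v0 vM].
have vE N : v *m defect E omega t N = - ((1 - tau ^+ 2 * t ^+ 2) *: v).
  by rewrite /defect mulmxBr mulmxA vM mul0mx sub0r mul_mx_scalar.
case/negP: v0; apply/eqP/matrixP => i j; rewrite (ord1 i) mxE.
have := mulmx_cvg0 v (defect_cvg0 ct' tt') 0 j.
under eq_fun do rewrite vE.
move/(cvg_lim (@norm_hausdorff _ _)); rewrite norm_lim_cst => /eqP.
rewrite !mxE oppr_eq0 mulf_eq0.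
by rewrite subr_eq0 eq_sym (negbTE t1) => /eqP.
Qed.

Lemma psumE t N i j : psum E omega t N i j = \sum_(k < N) q k i j * t ^+ k.
Proof. by rewrite /psum summxE; apply: eq_bigr => k _; rewrite mxE mulrC. Qed.

(** Multiplying the defect by the adjugate gives the limit of [\det (M t)] times the partial sums;
    their moduli increase with the truncation, so each is below the limit. *)
Lemma detM_psum_le t t' K i j : conv_set t' -> 0 < t -> t < t' ->
  `|\det (M t) * psum E omega t K i j| <=
  `|(1 - tau ^+ 2 * t ^+ 2) * (\adj (M t)) i j|.
Proof.
move=> ct' t0 tt'; have atT : `|t| < t' by rewrite gtr0_norm.
have E1 N : \det (M t) * psum E omega t N.+3 i j =
    (1 - tau ^+ 2 * t ^+ 2) * (\adj (M t)) i j + (\adj (M t) *m defect E omega t N) i j.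
  rewrite /defect mulmxBr mulmxA mul_adj_mx mul_mx_scalar mul_scalar_mx.
  by move: (psum _ _ _ _) (\adj _) => P Q; rewrite !mxE; ring.
have c : `|\det (M t) * psum E omega t N.+3 i j| @[N --> \oo] -->
    `|(1 - tau ^+ 2 * t ^+ 2) * (\adj (M t)) i j|.
  apply: cvg_norm; rewrite (funext E1) -[X in _ --> X]addr0.
  apply: cvgD; first exact: cvg_cst.
  exact: mulmx_cvg0 (defect_cvg0 ct' atT) i j.
have pos k : 0 <= q k i j * t ^+ k by rewrite mulr_ge0 ?exprn_ge0 ?(ltW t0).
apply: (cvgr_to_ge c); near=> N.
have KN : (K <= N.+3)%N.
  rewrite -addn3 (leq_trans _ (leq_addr _ _)) //.
  by near: N; exact: nbhs_infty_ge.
rewrite !normrM ler_wpM2l // !psumE !ger0_norm ?sumr_ge0 //.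
rewrite -!(big_mkord xpredT (fun k => q k i j * t ^+ k)).
by rewrite (big_cat_nat (leq0n K) KN) /= lerDl sumr_ge0.
Unshelve. all: by end_near. Qed.

(** With an indeterminate for [t], both sides of the adjugate bound become polynomials, so the bound
    passes to the left limit at [r]. *)
Definition Mpoly : 'M[{poly R}]_n :=
  1%:M - 'X *: map_mx polyC (adjmx R E)
  + (tau *: 'X^2) *: map_mx polyC (Dmx R E - tau%:M)
  + (tau ^+ 2 *: 'X^3) *: map_mx polyC (adjmx R E - Smx R E).

Lemma MpolyE t : map_mx (horner_eval t) Mpoly = M t.
Proof.
apply/matrixP => i j; rewrite /Mpoly /Mtau.
move: (adjmx R E - Smx R E) (Dmx R E - tau%:M) => S' D'.
by rewrite !mxE /horner_eval !hornerE; case: (i == j); rewrite !hornerE.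
Qed.

Lemma detM_eq0 r : 0 < r -> (forall t, 0 <= t -> t < r -> conv_set t) ->
  ~ conv_set r -> \det (M r) = 0.
Proof.
move=> r0 cr ncr; apply/eqP/negPn/negP => det0.
pose B := \sum_i \sum_j `|(1 - tau ^+ 2 * r ^+ 2) * (\adj (M r)) i j|.
have ge1 k : (0 < k)%N -> 1 <= s k * r ^+ k.
  move=> k0; rewrite leNgt; apply/negP => lt1; apply: ncr.
  by split; [exact: ltW | exists k].
have le_adj K i j : `|\det (M r) * psum E omega r K i j| <=
    `|(1 - tau ^+ 2 * r ^+ 2) * (\adj (M r)) i j|.
  pose p := \det Mpoly * \sum_(k < K) (q k i j) *: 'X^k.
  pose p' := (1 - (tau ^+ 2) *: 'X^2) * (\adj Mpoly) i j.
  have pE t : p.[t] = \det (M t) * psum E omega t K i j.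
    rewrite hornerM -MpolyE det_map_mx /horner_eval; congr (_ * _).
    by rewrite psumE horner_sum; apply: eq_bigr => k _; rewrite hornerZ hornerXn.
  have p'E t : p'.[t] = (1 - tau ^+ 2 * t ^+ 2) * (\adj (M t)) i j.
    rewrite hornerM -MpolyE -map_mx_adj [in RHS]mxE /horner_eval; congr (_ * _).
    by rewrite !hornerE.
  rewrite -pE -p'E; apply: poly_abs_le_left => // t t0 tr; rewrite pE p'E.
  have mid : t < (t + r) / 2 < r by apply/andP; split; lra.
  case/andP: mid => m1 m2.
  by apply: (@detM_psum_le t ((t + r) / 2)) => //; apply: cr => //; lra.
(* Each of the [K] terms [s k * r ^+ k] with [1 <= k <= K] is at least 1. *)
have le_B K : `|\det (M r)| * K%:R <= B.
  apply: (@le_trans _ _ (\sum_i \sum_j `|\det (M r) * psum E omega r K.+1 i j|));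
    last first.
    by do 2!apply: ler_sum => ? _.
  have pos k i j : 0 <= q k i j * r ^+ k by rewrite mulr_ge0 ?exprn_ge0 ?(ltW r0).
  have -> : \sum_i \sum_j `|\det (M r) * psum E omega r K.+1 i j| =
      `|\det (M r)| * \sum_(k < K.+1) s k * r ^+ k.
    rewrite big_distrr /=.
    under eq_bigr => i _.
      under eq_bigr => j _.
        rewrite normrM [X in _ * X]ger0_norm psumE ?sumr_ge0 // big_distrr /=.
        over.
      rewrite exchange_big /=.
      over.
    rewrite exchange_big /=; apply: eq_bigr => k _.
    rewrite /qsum !big_distrl big_distrr /=; apply: eq_bigr => i _.
    by rewrite !big_distrl big_distrr.
  rewrite ler_wpM2l // big_ord_recl /=.
  apply: (@le_trans _ _ (\sum_(k < K) s (lift ord0 k) * r ^+ (lift ord0 k))).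
    rewrite -[K in K%:R]card_ord -sumr_const; apply: ler_sum => k _.
    exact: ge1.
  by rewrite lerDr mulr_ge0 ?qsum_ge0 ?exprn_ge0 ?(ltW r0).
have d0 : 0 < `|\det (M r)| by rewrite normr_gt0.
have B0 : 0 <= B by apply: le_trans (le_B 0%N); rewrite mulr0.
have := archi_boundP (divr_ge0 B0 (ltW d0)); rewrite ltNge => /negP; apply.
by rewrite ler_pdivlMr // mulrC.
Qed.

(** * Exponential growth from a branching arc *)

Lemma nb_arc_weight k e f j : nb E e f ->
  arc_weight E omega k f.1 f.2 j <= arc_weight E omega k.+1 e.1 e.2 j.
Proof.
case: e f => [a b] [b' c] /and4P[/= _ Ebc /eqP-> ac]; rewrite -/b'.
(* The step to [c] does not backtrack, so it costs no factor [omega]. *)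
rewrite (bigD1 c) //= [c == a]eq_sym (negbTE ac) mul1r lerDl.
apply: sumr_ge0 => d _; apply: mulr_ge0; first by case: ifP.
exact: arc_weight_ge0.
Qed.

Lemma connect_arc_weight e f : connect (nb E) e f -> exists m, forall k j,
  arc_weight E omega k f.1 f.2 j <= arc_weight E omega (k + m) e.1 e.2 j.
Proof.
case/connectP => p; elim: p e => [|g p IH] e /=.
  by move=> _ ->; exists 0%N => k j; rewrite addn0.
case/andP => eg pg ef; have [m mP] := IH g pg ef; exists m.+1 => k j.
by apply: le_trans (mP k j) _; rewrite addnS; apply: nb_arc_weight.
Qed.

Lemma branching_qsum : branching E -> exists L, forall k, 2 ^+ k <= s (k * L.+1).
Proof.
move=> [e [f [g [fg ef eg /connect_arc_weight[m1 h1] /connect_arc_weight[m2 h2]]]]].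
pose X k := arc_weight E omega k e.1 e.2 e.2.
have loop m h : (forall k j, arc_weight E omega k e.1 e.2 j <=
    arc_weight E omega (k + m) h.1 h.2 j) -> nb E e h -> forall k l,
    X k <= X (k + l * m.+1)%N.
  move=> hm eh k; elim=> [|l IH]; first by rewrite addn0.
  apply: le_trans IH _; have -> : (k + l.+1 * m.+1 = (k + l * m.+1 + m).+1)%N by lia.
  exact: le_trans (hm _ _) (nb_arc_weight _ _ eh).
(* The closed walks through [e] via [f] and via [g] have lengths [m1.+1] and [m2.+1]; repeating them
   [m2.+1] and [m1.+1] times gives the common length [L.+1]. *)
have [L Le] : exists L, L.+1 = (m1.+1 * m2.+1)%N by exists (m1.+1 * m2.+1).-1.
have dbl k : 2 * X k <= X (k + L.+1)%N.
  have le2 : arc_weight E omega (k + L) f.1 f.2 e.2 +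
     arc_weight E omega (k + L) g.1 g.2 e.2 <= X (k + L.+1)%N.
    rewrite addnS /X.
    case: e f g fg ef eg {h1 h2 loop X} => a b [b1 c] [b2 d] cd.
    move=> /and4P[/= _ Ebc /eqP e1 ac] /and4P[/= _ Ebd /eqP e2 ad].
    subst b1 b2.
    have dc : d != c by apply: contraNneq cd => ->.
    rewrite (bigD1 c) //= (bigD1 d) /= ?Ebd // addrA.
    rewrite [c == a]eq_sym (negbTE ac) [d == a]eq_sym (negbTE ad) !mul1r lerDl.
    apply: sumr_ge0 => x _; apply: mulr_ge0; first by case: ifP.
    exact: arc_weight_ge0.
  apply: le_trans le2; rewrite mulr2n mulrDl mul1r; apply: lerD.
    have -> : (k + L = (k + m2 * m1.+1) + m1)%N by lia.
    by apply: le_trans (h1 _ _); apply: loop h1 ef _ _.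
  have -> : (k + L = (k + m1 * m2.+1) + m2)%N by lia.
  by apply: le_trans (h2 _ _); apply: loop h2 eg _ _.
exists L => k; apply: (@le_trans _ _ (X (k * L.+1)%N)); last first.
  by apply: le_trans (qmx_le_qsum _ e.2 e.2); exact: arc_weight_le_qmx.
elim: k => [|k IH]; first by rewrite /X /= eqxx.
rewrite mulSn addnC exprS; apply: le_trans (dbl _).
by rewrite ler_wpM2l.
Qed.

Lemma conv_set_lt L t : (forall k, 2 ^+ k <= s (k * L.+1)) ->
  conv_set t -> 2 * t ^+ L.+1 < 1.
Proof.
move=> gr [t0 [m m0 lt1]]; rewrite ltNge; apply/negP => ge1.
have : 1 <= (2 * t ^+ L.+1) ^+ m by rewrite exprn_ege1.
rewrite leNgt => /negP; apply.
(* The lower and upper growth bounds meet at walk length [m * L.+1]. *)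
apply: (@le_lt_trans _ _ ((s m * t ^+ m) ^+ L.+1)).
  rewrite !exprMn -!exprM [(L.+1 * m)%N]mulnC ler_wpM2r ?exprn_ge0 //.
  exact: le_trans (gr m) (qsumM _ _).
by rewrite exprn_ilt1 // mulr_ge0 ?qsum_ge0 ?exprn_ge0.
Qed.

End Radius.

Theorem theorem4p14 (R : realType) (n : nat) (E : rel 'I_n)
    (Eirr : forall i, ~~ E i i) (omega : R)
    (homega0 : 0 <= omega) (homega1 : omega < 1) :
  (exists v : 'I_n, has_more_than_one_cycle (undir_adj E (scc E v))) ->
  exists mu r : R,
    smallest_pos_eigenvalue E (1 - omega) mu /\
    radius_of_convergence (qmx E omega) r /\
    mu = r /\ r < (1 - omega)^-1.
Proof.
move=> [v /two_cycles_branching br].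
have [L gr] := branching_qsum homega0 homega1 br.
pose T := conv_set E omega.
(* Any [b < 1] with [2 * b ^+ L.+1 > 1] bounds [T]; such a bound makes the supremum strictly less
   than 1. *)
have [b b1 bT] : exists2 b, b < 1 & forall t, T t -> t <= b.
  have c : (2 *: 'X^(L.+1) : {poly R}).[x] @[x --> 1^'-] -->
      (2 *: 'X^(L.+1) : {poly R}).[1].
    by apply: cvg_at_left_filter; apply: continuous_horner.
  have gt1 : 1 < (2 *: 'X^(L.+1) : {poly R}).[1].
    by rewrite hornerZ hornerXn expr1n mulr1 ltr1n.
  have near1 : \forall x \near 1^'-, 1 < (2 *: 'X^(L.+1) : {poly R}).[x].
    exact: cvgr_gt c _ gt1.
  near (1 : R)^'- => b; exists b; first by near: b; exact: nbhs_left_lt.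
  move=> t Tt; rewrite leNgt; apply/negP => bt.
  have b0 : 0 <= b by near: b; apply: nbhs_left_ge; exact: ltr01.
  have Tb : T b by apply: (conv_set_down homega0 b0 (ltW bt) Tt).
  have := conv_set_lt homega0 homega1 gr Tb; rewrite ltNge => /negP; apply.
  have : 1 < (2 *: 'X^(L.+1) : {poly R}).[b] by near: b.
  by rewrite hornerZ hornerXn => /ltW.
have T0 : T 0 := conv_set0 E omega.
have supT : has_sup T by split; [exists 0 | exists b; apply/ubP].
pose r := sup T.
have rub t : T t -> t <= r by exact: sup_upper_bound.
have ltT (t : R) : 0 <= t -> t < r -> T t.
  move=> t0 tr; have rt0 : 0 < r - t by rewrite subr_gt0.
  have [t' Tt' tt'] := sup_adherent rt0 supT.
  by apply: (conv_set_down homega0 t0 _ Tt'); move: tt'; rewrite subKr => /ltW.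
have nT t : r <= t -> ~ T t.
  move=> rt Tt; have [t' tt' /rub t'r] := conv_set_open Tt.
  by have := lt_le_trans tt' (le_trans t'r rt); rewrite ltxx.
have r0 : 0 < r.
  by rewrite ltNge; apply/negP => /nT; apply.
have r1 : r < 1 by apply: le_lt_trans b1; apply: ge_sup; [exists 0 | apply/ubP].
(* The convergence lemmas need a point of [T] strictly beyond the modulus of [t]; the midpoint to
   [r] is one. *)
have btw (t : R) : `|t| < r -> exists2 t', T t' & `|t| < t'.
  move=> tr; exists ((`|t| + r) / 2); last by lra.
  by apply: ltT; [have := normr_ge0 t; lra | lra].
exists r, r; split; last split; last split => //.
- split=> //; split; first exact: (detM_eq0 homega0 homega1 r0 ltT (nT r (lexx r))).
  move=> t t0 tr; have [|t' Tt' tt'] := btw t; first by rewrite gtr0_norm.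
  apply: (detM_neq0 homega0 homega1 Tt' tt').
  (* Here [tau * t < 1], because [tau <= 1] and [t < r < 1]. *)
  by rewrite -exprMn lt_eqF // exprn_ilt1 // ?mulr_ge0 //; nra.
- split; first exact: ltW; split=> t tr.
    by have [t' Tt' tt'] := btw t tr; exact: (conv_set_cvg homega0 homega1 Tt' tt').
  by apply: (conv_setN_ncvg homega0); apply: nT; exact: ltW.
- by apply: lt_le_trans r1 _; rewrite invf_ge1 ?subr_gt0 // lerBlDr lerDl.
Unshelve. all: by end_near. Qed.
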